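(* Let $x_0\in(0,\pi/2)$ and put $a=-\dfrac{\log\cos x_0}{x_0^2}$. Then for every $x\in(0,x_0)$ the following inequalities hold: $$e^{-ax^2}<\cos x<e^{-x^2/2},$$ and the constants $a$ and $1/2$ are the best possible; that is, $a$ is the smallest real number $\alpha$ such that $e^{-\alpha x^2}<\cos x$ for all $x\in(0,x_0)$, and $1/2$ is the largest real number $\beta$ such that $\cos x<e^{-\beta x^2}$ for all $x\in(0,x_0)$.
   Context: $\log$ denotes the natural logarithm. *)

(* Defs.v *)
From Stdlib Require Import Reals.
Open Scope R_scope.

Definition is_smallest (E : R -> Prop) (m : R) : Prop :=
  E m /\ forall y : R, E y -> m <= y.

Definition is_largest (E : R -> Prop) (m : R) : Prop :=
  E m /\ forall y : R, E y -> y <= m.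

(* Main.v *)
Require Import Defs.
From Stdlib Require Import Reals Lra.
From Coquelicot Require Import Coquelicot.
Open Scope R_scope.

(** Both inequalities compare [g x = - ln (cos x) / x ^ 2] with constants: they
    say [1 / 2 < g x < g x0 = a].  The logarithm of the upper bound reduces to
    [ln (cos x) + x ^ 2 / 2 < 0]: the left side vanishes at [0] and has
    derivative [x - tan x < 0].  The lower bound is the strict monotonicity of
    [g] ([ln_cos_ratio_increasing]), whose derivative is
    [(x tan x + 2 ln (cos x)) / x ^ 3]; the numerator vanishes at [0] and has
    derivative [(x - sin x cos x) / cos ^ 2 x > 0].

    The constants are optimal because they are the limits of [g] at the two ends
    of the interval.  At [x0] an admissible [alpha] satisfies the limiting weak
    inequality by continuity ([nonneg_at_right_endpoint]), which is
    [a <= alpha].  At [0] an admissible [beta > 1 / 2] would contradict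
    [1 - x ^ 2 / 2 <= cos x] together with
    [exp (- beta x ^ 2) <= 1 / (1 + beta x ^ 2)] for small [x]. *)

Lemma increasing_of_deriv_pos (f f' : R -> R) (a b : R) :
  a < b ->
  (forall x, a <= x <= b -> is_derive f x (f' x)) ->
  (forall x, a < x < b -> 0 < f' x) ->
  f a < f b.
Proof.
  intros Hab Hf Hpos.
  destruct (MVT_cor2 f f' a b Hab) as [c [Hc Hcab]].
  { intros c Hc. now apply is_derive_Reals, Hf. }
  pose proof (Hpos c Hcab). nra.
Qed.

Lemma cos_pos_quarter (x : R) : 0 <= x < PI / 2 -> 0 < cos x.
Proof. intros Hx. apply cos_gt_0; lra. Qed.

Lemma tan_gt_id (x : R) : 0 < x < PI / 2 -> x < tan x.
Proof.
  intros Hx.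
  enough (tan 0 - 0 < tan x - x) by (rewrite tan_0 in *; lra).
  apply (increasing_of_deriv_pos (fun t => tan t - t) (fun t => tan t ^ 2)).
  - lra.
  - intros t Ht. assert (Hc : 0 < cos t) by (apply cos_pos_quarter; lra).
    unfold tan. auto_derive; [lra |].
    pose proof (sin2_cos2 t) as Hsc. unfold Rsqr in Hsc.
    apply (Rmult_eq_reg_r (cos t ^ 2)); [| apply pow_nonzero; lra].
    field_simplify; [| lra | lra].
    nra.
  - intros t Ht. apply pow_lt, tan_gt_0; lra.
Qed.

Lemma ln_cos_lt (x : R) : 0 < x < PI / 2 -> ln (cos x) < - x ^ 2 / 2.
Proof.
  intros Hx.
  enough (- ln (cos 0) - 0 ^ 2 / 2 < - ln (cos x) - x ^ 2 / 2)
    by (rewrite cos_0, ln_1 in *; lra).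
  apply (increasing_of_deriv_pos (fun t => - ln (cos t) - t ^ 2 / 2)
           (fun t => tan t - t)).
  - lra.
  - intros t Ht. assert (Hc : 0 < cos t) by (apply cos_pos_quarter; lra).
    auto_derive; [exact Hc | unfold tan; field; lra].
  - intros t Ht. pose proof (tan_gt_id t). lra.
Qed.

(** Over [x ^ 3] this is the derivative of [- ln (cos x) / x ^ 2].  It vanishes
    at [0], and its own derivative is positive because [sin x cos x < x]. *)
Lemma x_tan_plus_2_ln_cos_pos (x : R) :
  0 < x < PI / 2 -> 0 < x * tan x + 2 * ln (cos x).
Proof.
  intros Hx.
  enough (0 * tan 0 + 2 * ln (cos 0) < x * tan x + 2 * ln (cos x))
    by (rewrite cos_0, ln_1 in *; lra).
  apply (increasing_of_deriv_pos (fun t => t * tan t + 2 * ln (cos t))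
           (fun t => (t - sin t * cos t) / cos t ^ 2)).
  - lra.
  - intros t Ht. assert (Hc : 0 < cos t) by (apply cos_pos_quarter; lra).
    unfold tan. auto_derive; [repeat split; lra |].
    pose proof (sin2_cos2 t) as Hsc. unfold Rsqr in Hsc.
    apply (Rmult_eq_reg_r (cos t ^ 2)); [| apply pow_nonzero; lra].
    field_simplify; [| lra | lra].
    nra.
  - intros t Ht. assert (Hc : 0 < cos t) by (apply cos_pos_quarter; lra).
    apply Rdiv_lt_0_compat; [| apply pow_lt; lra].
    assert (0 < sin t) by (apply sin_gt_0; lra).
    pose proof (sin_lt_x t). pose proof (COS_bound t). nra.
Qed.

Lemma ln_cos_ratio_increasing (x y : R) :
  0 < x -> x < y -> y < PI / 2 ->
  - ln (cos x) / x ^ 2 < - ln (cos y) / y ^ 2.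
Proof.
  intros Hx Hxy Hy.
  apply (increasing_of_deriv_pos (fun t => - ln (cos t) / t ^ 2)
           (fun t => (t * tan t + 2 * ln (cos t)) / t ^ 3)).
  - exact Hxy.
  - intros t Ht. assert (Hc : 0 < cos t) by (apply cos_pos_quarter; lra).
    auto_derive.
    + split; [exact Hc | split; [| exact I]]. nra.
    + unfold tan. field. lra.
  - intros t Ht. apply Rdiv_lt_0_compat; [| apply pow_lt; lra].
    apply x_tan_plus_2_ln_cos_pos. lra.
Qed.

(** Half-angle form of [|sin (x / 2)| <= x / 2], through
    [cos x = 1 - 2 sin ^ 2 (x / 2)]. *)
Lemma cos_ge_quadratic (x : R) : 0 < x -> 1 - x ^ 2 / 2 <= cos x.
Proof.
  intros Hx.
  replace (cos x) with (1 - 2 * sin (x / 2) * sin (x / 2))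
    by (rewrite <- cos_2a_sin; f_equal; field).
  assert (Hs : Rsqr (sin (x / 2)) <= Rsqr (x / 2)).
  { apply Rsqr_le_abs_1. rewrite (Rabs_pos_eq (x / 2)) by lra.
    destruct (Rle_lt_dec (x / 2) 1) as [H1 | H1].
    - pose proof PI2_1. pose proof (sin_lt_x (x / 2)).
      assert (0 < sin (x / 2)) by (apply sin_gt_0; lra).
      rewrite Rabs_pos_eq; lra.
    - pose proof (SIN_bound (x / 2)). apply Rabs_le. lra. }
  unfold Rsqr in Hs. nra.
Qed.

Lemma nonneg_at_right_endpoint (f : R -> R) (a b : R) :
  a < b -> continuity_pt f b -> (forall x, a < x < b -> 0 < f x) -> 0 <= f b.
Proof.
  intros Hab Hf Hpos.
  destruct (Rle_lt_dec 0 (f b)) as [H | Hneg]; [exact H | exfalso].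
  destruct (Hf (- f b)) as [d [Hd Hnear]]; [lra |].
  pose proof (Rmin_l (b - a) d). pose proof (Rmin_r (b - a) d).
  pose proof (Rmin_pos (b - a) d ltac:(lra) Hd).
  set (x := b - Rmin (b - a) d / 2).
  assert (Hx : a < x < b) by (unfold x; lra).
  specialize (Hpos x Hx).
  assert (Hclose : Rabs (f x - f b) < - f b).
  { apply (Hnear x). split.
    - split; [exact I | lra].
    - simpl. unfold Rdist. apply Rabs_def1; unfold x; lra. }
  apply Rabs_def2 in Hclose. lra.
Qed.

(** A bound [cos x < exp (- beta x ^ 2)] near [0] forces [beta <= 1 / 2], by
    comparison of the terms of order [x ^ 2]. *)
Lemma gaussian_majorant_rate_le_half (beta x0 : R) :
  0 < x0 ->
  (forall x, 0 < x < x0 -> cos x < exp (- beta * x ^ 2)) ->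
  beta <= 1 / 2.
Proof.
  intros Hx0 Hmaj.
  destruct (Rle_lt_dec beta (1 / 2)) as [H | Hb]; [exact H | exfalso].
  (* With x <= (beta - 1/2) / beta < 1, the fourth order term beta x^4 / 2 of
     (1 - x^2 / 2) (1 + beta x^2) is less than the second order term
     (beta - 1/2) x^2. *)
  set (q := (beta - 1 / 2) / beta).
  assert (Hq : q * beta = beta - 1 / 2) by (unfold q; field; lra).
  assert (Hq0 : 0 < q) by (apply Rdiv_lt_0_compat; lra).
  assert (Hq1 : q < 1) by nra.
  set (x := Rmin (x0 / 2) q).
  assert (Hx : 0 < x) by (apply Rmin_pos; lra).
  assert (Hxx0 : x < x0) by (pose proof (Rmin_l (x0 / 2) q); unfold x; lra).
  assert (Hxq : x <= q) by apply Rmin_r.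
  specialize (Hmaj x (conj Hx Hxx0)).
  pose proof (cos_ge_quadratic x Hx) as Hcos.
  assert (Hx2 : 0 < x ^ 2) by (apply pow_lt; exact Hx).
  pose proof (exp_ineq1_le (beta * x ^ 2)) as Hexp.
  assert (Hinv : exp (- beta * x ^ 2) * exp (beta * x ^ 2) = 1).
  { rewrite <- exp_plus. replace (_ + _) with 0 by ring. apply exp_0. }
  assert (Hprod : exp (- beta * x ^ 2) * (1 + beta * x ^ 2) <= 1).
  { rewrite <- Hinv at 2. apply Rmult_le_compat_l; [left; apply exp_pos | exact Hexp]. }
  assert (Hbx : 0 < 1 + beta * x ^ 2) by nra.
  assert (Hlt : (1 - x ^ 2 / 2) * (1 + beta * x ^ 2) < 1).
  { apply Rlt_le_trans with (2 := Hprod).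
    apply Rmult_lt_compat_r; lra. }
  assert (Hsmall : beta * x ^ 2 <= beta - 1 / 2).
  { rewrite <- Hq, (Rmult_comm q). apply Rmult_le_compat_l; [lra |]. nra. }
  nra.
Qed.

Theorem theorem2p3 (x0 : R) (hx0 : 0 < x0 < PI / 2) :
  let a := - (ln (cos x0) / x0 ^ 2) in
  (forall x : R, 0 < x < x0 ->
     exp (- a * x ^ 2) < cos x /\ cos x < exp (- x ^ 2 / 2)) /\
  is_smallest
    (fun alpha : R =>
       forall x : R, 0 < x < x0 -> exp (- alpha * x ^ 2) < cos x) a /\
  is_largest
    (fun beta : R =>
       forall x : R, 0 < x < x0 -> cos x < exp (- beta * x ^ 2)) (1 / 2).
Proof.
  intros a.
  assert (Hlower : forall x, 0 < x < x0 -> exp (- a * x ^ 2) < cos x).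
  { intros x Hx.
    assert (Hc : 0 < cos x) by (apply cos_pos_quarter; lra).
    rewrite <- (exp_ln (cos x) Hc). apply exp_increasing.
    pose proof (ln_cos_ratio_increasing x x0) as Hmono.
    assert (Hx2 : 0 < x ^ 2) by (apply pow_lt; lra).
    replace (ln (cos x)) with (- (- ln (cos x) / x ^ 2) * x ^ 2) by (field; lra).
    apply Rmult_lt_compat_r; [exact Hx2 |].
    unfold a, Rdiv in *. lra. }
  assert (Hupper : forall x, 0 < x < x0 -> cos x < exp (- x ^ 2 / 2)).
  { intros x Hx.
    assert (Hc : 0 < cos x) by (apply cos_pos_quarter; lra).
    rewrite <- (exp_ln (cos x) Hc) at 1. apply exp_increasing, ln_cos_lt. lra. }
  split; [| split; split].
  - auto.
  - exact Hlower.
  - intros alpha Halpha.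
    assert (Hc : 0 < cos x0) by (apply cos_pos_quarter; lra).
    assert (Hend : 0 <= cos x0 - exp (- alpha * x0 ^ 2)).
    { apply (nonneg_at_right_endpoint
               (fun x => cos x - exp (- alpha * x ^ 2)) 0 x0).
      - lra.
      - apply derivable_continuous_pt, ex_derive_Reals_0. now auto_derive.
      - intros x Hx. specialize (Halpha x Hx). lra. }
    assert (Hln : - alpha * x0 ^ 2 <= ln (cos x0)).
    { rewrite <- (ln_exp (- alpha * x0 ^ 2)). apply ln_le; [apply exp_pos | lra]. }
    assert (Hx2 : 0 < x0 ^ 2) by (apply pow_lt; lra).
    apply (Rmult_le_reg_r (x0 ^ 2)); [exact Hx2 |].
    replace (a * x0 ^ 2) with (- ln (cos x0)) by (unfold a; field; lra). lra.
  - intros x Hx. replace (- (1 / 2) * x ^ 2) with (- x ^ 2 / 2) by field.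
    now apply Hupper.
  - intros beta. apply gaussian_majorant_rate_le_half. lra.
Qed.
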